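(* Let $\rho>0$, $\sigma^2>0$, $M_R\le M_T$, let $\mathbf g\in\mathbb C^{M_R}$, $\mathbf h\in\mathbb C^{M_T}$ have unit-modulus entries, $\mathbf H=\mathbf g\mathbf h^T$, $\mathrm{vec}(\mathbf\Phi)\sim\mathcal N(\mathbf 0,\sigma^2\mathbf I_{M_TM_R})$ real, $\hat{\mathbf H}=\mathbf H\circ(\mathbf 1+j\mathbf\Phi)$ and $\hat C=\mathbb E\{\log_2\det(\mathbf I_{M_R}+\frac{\rho}{M_T}\hat{\mathbf H}\hat{\mathbf H}^H)\}$. Then $$\hat C\le\log_2\Big(1+\sum_{n=1}^{M_R}\Big(\frac{\rho}{M_T}\Big)^n(\sigma^2)^n\binom{M_R}{n}\binom{M_T}{n}n!\Big(1+\frac{n}{\sigma^2}\Big)\Big).$$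
   Context: $\circ$ is the Hadamard product and $\mathbf 1$ the all-ones $M_R\times M_T$ matrix. *)

(* Defs.v *)
From HB Require Import structures.
From mathcomp Require Import all_boot all_order all_algebra.
From mathcomp Require Import all_classical all_reals all_analysis.
From mathcomp Require Import complex.
Set Implicit Arguments. Unset Strict Implicit. Unset Printing Implicit Defensive.
Import Order.TTheory GRing.Theory Num.Theory.

Local Open Scope classical_set_scope.
Local Open Scope ring_scope.

Definition mutually_independent_RVs {d} {T : measurableType d} {R : realType}
  (P : probability T R) (I : finType) (X : I -> {RV P >-> R}) : Prop :=
  forall (J : {set I}) (B : I -> set R), (forall i, measurable (B i)) ->
    P (\bigcap_(i in [set` J]) (X i @^-1` B i)) =
    (\prod_(i in J) P (X i @^-1` B i))%E.

Definition log2 {R : realType} (x : R) : R := ln x / ln 2.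

Definition ctrmx {R : rcfType} m n (A : 'M[R[i]]_(m, n)) : 'M[R[i]]_(n, m) :=
  \matrix_(i, j) conjc (A j i).

(* Main.v *)
(** The unimodular factors of [H] cancel, leaving
    [Y = det (1 + c A A^H)] with [A = 1 + j Phi] and [c = rho / M_T].
    Expanding every row of [1 + c A A^H] as the sum of a row of the identity
    and of the contributions of the columns of [A], multilinearity writes [Y]
    as a sum over partial maps [f] from rows to columns.  If [f] is not
    injective on its support, the determinant has two proportional rows and
    vanishes.  Otherwise distinct rows involve distinct, independent columns of
    [Phi], and the mean of the term is [c^n det (J + sigma2 I)], of size
    [n = #|supp f|], that is, [c^n sigma2^n (1 + n / sigma2)].  There are
    ['C(M_R, n) 'C(M_T, n) n!] such [f], so [E Y] is the argument of the
    logarithm on the right, and Jensen's inequality concludes; [Y > 0] because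
    it is a Gram determinant. *)

Require Import Defs.
From HB Require Import structures.
From mathcomp Require Import all_boot all_order all_algebra.
From mathcomp Require Import fingroup perm ring lra.
From mathcomp Require Import all_classical all_reals all_analysis.
From mathcomp Require Import complex.
(* [all_analysis] alone does not make the measurable structure of [\bar R]
   canonical. *)
From mathcomp Require Import measurable_realfun.
Import Order.TTheory GRing.Theory Num.Theory.
Import HBNNSimple numFieldNormedType.Exports.
Local Open Scope classical_set_scope.
Local Open Scope ring_scope.

(** * Densities, image measures and products of independent variables *)

(** The hypothesis on [nu] is the case of indicators; linearity extends it to simple functions and
    monotone convergence to nonnegative ones. It serves for a law with a density and for a weight
    made of the other independent factors. *)
Lemma ge0_integral_density {d d'} {T : measurableType d}
    {T' : measurableType d'} {R : realType} (mu : {measure set T -> \bar R})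
    (nu : {measure set T' -> \bar R}) (w : T -> R) (X : T -> T') :
  measurable_fun setT w -> (forall x, 0 <= w x) -> measurable_fun setT X ->
  (forall B, measurable B ->
     nu B = (\int[mu]_(x in X @^-1` B) (w x)%:E)%E) ->
  forall f : T' -> \bar R, measurable_fun setT f -> (forall y, (0 <= f y)%E) ->
  (\int[nu]_y f y = \int[mu]_x ((w x)%:E * f (X x)))%E.
Proof.
move=> mw w0 mX nuE f mf f0.
have mXB B : measurable B -> measurable (X @^-1` B).
  by move=> mB; rewrite -[_ @^-1` _]setTI; exact: mX.
pose h := nnsfun_approx measurableT mf.
have nndw n x : (0 <= (w x)%:E * (h n (X x))%:E)%E.
  by rewrite mule_ge0 ?lee_fin.
have mh n : measurable_fun setT (h n) by exact: measurable_funPT.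
have fE y : f y = (lim ((h n y)%:E @[n --> \oo]))%E.
  by apply/esym/cvg_lim => //; exact: cvg_nnsfun_approx.
have wfE x : ((w x)%:E * f (X x) =
    lim (((w x)%:E * (h n (X x))%:E) @[n --> \oo]))%E.
  by apply/esym/cvg_lim => //; apply: cvgeZl => //; exact: cvg_nnsfun_approx.
under eq_integral do rewrite fE.
under [RHS]eq_integral do rewrite wfE.
rewrite monotone_convergence//; last 3 first.
- by move=> n; exact/measurable_EFinP.
- by move=> n y _; rewrite lee_fin.
- by move=> y _ a b ab; rewrite lee_fin; exact/lefP/nd_nnsfun_approx.
rewrite monotone_convergence//; last 2 first.
- move=> n; apply: emeasurable_funM; first exact/measurable_EFinP.
  by apply/measurable_EFinP; exact: measurableT_comp.
- move=> x _ a b ab; apply: lee_wpmul2l; first by rewrite lee_fin.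
  by rewrite lee_fin; exact/lefP/nd_nnsfun_approx.
suff suf n : (\int[nu]_y (h n y)%:E =
    \int[mu]_x ((w x)%:E * (h n (X x))%:E))%E.
  by under eq_fun do rewrite suf.
have mpre r : measurable (h n @^-1` [set r]).
  by rewrite -[_ @^-1` _]setTI; exact: mh.
under eq_integral do rewrite fimfunE -fsumEFin//.
rewrite ge0_integral_fsum//; last 2 first.
- by move=> r; exact/measurable_EFinP/measurableT_comp.
- by move=> r y _; rewrite EFinM nnfun_muleindic_ge0.
under [RHS]eq_integral.
  move=> x _; rewrite fimfunE -fsumEFin// ge0_mule_fsumr; last first.
    by move=> r; rewrite EFinM nnfun_muleindic_ge0.
  over.
rewrite ge0_integral_fsum//; last 2 first.
- move=> r; apply: emeasurable_funM; first exact/measurable_EFinP.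
  apply/measurable_EFinP/measurable_funM => //.
  exact: (measurableT_comp (measurable_indic _)).
- by move=> r x _; rewrite EFinM mule_ge0 ?nnfun_muleindic_ge0 ?lee_fin.
apply: eq_fsbigr => r _.
rewrite integralZl_indic_nnsfun// integral_indic// setIT.
(* The sum runs over all real [r]; a negative value has an empty preimage, so both sides vanish
   there. *)
have [r0|r0] := ltP r 0.
  rewrite preimage_nnfun0// measure0 mule0 integral0_eq// => x _.
  by rewrite indicE in_set0 mulr0 mule0.
rewrite nuE// integral_mkcond -ge0_integralZl_EFin//; last 2 first.
- by move=> x _; rewrite patchE; case: ifP; rewrite ?lee_fin.
- apply/(measurable_restrictT _ _).1; first exact: mXB.
  exact/measurable_EFinP/measurable_funTS.
apply: eq_integral => x _; rewrite patchE indicE.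
have -> : (X x \in h n @^-1` [set r]) = (x \in X @^-1` (h n @^-1` [set r])).
  by apply/idP/idP; rewrite !inE.
by case: ifP => _; rewrite ?mulr1 ?mulr0 ?mule0 // muleC.
Qed.

(** Independence speaks of events only. To replace the indicator of one coordinate by [phi i], the
    product of the other factors is treated as a density with respect to [P]. *)
Lemma ge0_integral_prod_indep {d} {T : measurableType d} {R : realType}
    (P : probability T R) (I : finType) (X : I -> {RV P >-> R})
    (phi : I -> R -> R) (m : I -> R) :
  mutually_independent_RVs X ->
  (forall i, measurable_fun setT (phi i)) -> (forall i y, 0 <= phi i y) ->
  (forall i, (\int[P]_w (phi i (X i w))%:E = (m i)%:E)%E) ->
  (\int[P]_w (\prod_i phi i (X i w))%:E = (\prod_i m i)%:E)%E.
Proof.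
move=> indX.
have mX i : measurable_fun setT (X i) by exact: measurable_funPT.
have mXB i B : measurable B -> measurable (X i @^-1` B).
  by move=> mB; rewrite -[_ @^-1` _]setTI; exact: mX.
(* Generalized to let the functions outside [s] be indicators, so that each
   coordinate can be upgraded from indicators to [phi i] in turn. *)
suff gen (s : seq I) : forall (phi : I -> R -> R) (m : I -> R),
    (forall i, measurable_fun setT (phi i)) -> (forall i y, 0 <= phi i y) ->
    (forall i, i \notin s -> exists2 B, measurable B & phi i = \1_B) ->
    (forall i, (\int[P]_w (phi i (X i w))%:E = (m i)%:E)%E) ->
    (\int[P]_w (\prod_i phi i (X i w))%:E = (\prod_i m i)%:E)%E.
  by move=> mphi phi0; apply: (gen (enum I)) => // i; rewrite mem_enum.
elim: s => [|i s IH] {}phi {}m mphi phi0 phiB phim.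
  have /choice[B BP] : forall i, exists B, measurable B /\ phi i = \1_B.
    by move=> i; have [//|B mB ->] := phiB i; exists B.
  have mB i : measurable (B i) by case: (BP i).
  have phiE i w : phi i (X i w) = \1_(X i @^-1` B i) w.
    by rewrite (BP i).2 !indicE; congr (_ _); apply/idP/idP; rewrite !inE.
  have := indX [set: I]%SET B mB.
  rewrite (_ : \bigcap_(i in _) _ = \bigcap_i (X i @^-1` B i)); last first.
    by apply: eq_bigcapl; split => j _ //=; rewrite inE.
  move=> indE; transitivity (P (\bigcap_i (X i @^-1` B i))); last first.
    rewrite indE -prodEFin; apply: eq_big => [i|i _]; first by rewrite inE.
    rewrite -phim -[X in P X]setIT -integral_indic//; last exact: mXB.
    by apply: eq_integral => w _; rewrite phiE.
  rewrite -[X in P X]setIT -integral_indic//; last first.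
    by apply: fin_bigcap_measurable => // i _; exact: mXB.
  apply: eq_integral => w _; congr EFin; rewrite [RHS]indicE.
  under eq_bigr do rewrite phiE indicE.
  case: (boolP (w \in _)) => [|wN].
    rewrite inE => wB; rewrite big1// => i _.
    by rewrite mem_set//; exact: wB.
  have [i wi] : exists i, ~ (X i @^-1` B i) w.
    apply/existsNP => wB; move/negP : wN; apply; rewrite inE => i _; exact: wB.
  by rewrite (bigD1 i)//= memNset// mul0r.
pose W (w : T) := \prod_(j | j != i) phi j (X j w).
have W0 w : 0 <= W w by rewrite prodr_ge0.
have mW : measurable_fun setT W.
  rewrite (_ : W = fun w =>
      \prod_(j <- [seq j <- index_enum I | j != i]) phi j (X j w)); last first.
    by apply/funext => w; rewrite /W big_filter.
  by apply: measurable_prod => j _; exact: measurableT_comp.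
pose c := \prod_(j | j != i) m j.
have m0 j : 0 <= m j.
  rewrite -lee_fin -phim; apply: integral_ge0 => w _.
  by rewrite lee_fin.
have c0 : 0 <= c by rewrite prodr_ge0.
(* [nu] is the law of [X i] scaled by the product of the other means; [nuE] identifies it with the
   image under [X i] of the measure of density [W]. *)
pose nu := mscale (NngNum c0) (distribution P (X i)).
have nuE B : measurable B ->
    nu B = (\int[P]_(w in X i @^-1` B) (W w)%:E)%E.
  (* [phi'] carries an indicator at [i], so the induction hypothesis for the shorter list applies to
     it. *)
  move=> mB; pose phi' j := if j == i then \1_B else phi j.
  pose m' j := if j == i then fine (P (X i @^-1` B)) else m j.
  have ne j : (j != i) -> (j == i) = false by move/negbTE.
  transitivity (\prod_j m' j)%:E.
    rewrite (bigD1 i)//= {1}/m' eqxx (eq_bigr m); last first.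
      by move=> j /ne ji; rewrite /m' ji.
    rewrite EFinM fineK ?fin_num_measure//; last exact: mXB.
    by rewrite /nu /mscale/= muleC.
  rewrite -(IH phi').
  - rewrite [RHS]integral_mkcond; apply: eq_integral => w _.
    rewrite (bigD1 i)//= {1}/phi' eqxx patchE indicE.
    rewrite (eq_bigr (fun j => phi j (X j w))); last first.
      by move=> j /ne ji; rewrite /phi' ji.
    rewrite (_ : (X i w \in B) = (w \in X i @^-1` B)); last first.
      by apply/idP/idP; rewrite !inE.
    by case: ifP; rewrite ?mul1r ?mul0r.
  - by move=> j; rewrite /phi'; case: ifP => _//; exact: measurable_indic.
  - by move=> j y; rewrite /phi'; case: ifP.
  - move=> j js; rewrite /phi'; case: eqP => [_|/eqP ji]; first by exists B.
    by apply: phiB; rewrite inE negb_or ji.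
  - move=> j; rewrite /phi' /m'; case: eqP => [->|_]; last exact: phim.
    rewrite fineK ?fin_num_measure//; last exact: mXB.
    by rewrite -[X in P X]setIT -integral_indic//; exact: mXB.
transitivity (\int[P]_w ((W w)%:E * (phi i (X i w))%:E))%E.
  by apply: eq_integral => w _; rewrite (bigD1 i)//= EFinM muleC.
rewrite -(ge0_integral_density _ nu _ _ mW W0 (mX i) nuE (EFin \o phi i))//;
  last 2 first.
- exact/measurable_EFinP.
- by move=> y; rewrite lee_fin.
have mphii : measurable_fun setT (EFin \o phi i) by exact/measurable_EFinP.
rewrite ge0_integral_mscale//; last by move=> y _; rewrite lee_fin.
rewrite ge0_integral_distribution//; last by move=> y; rewrite lee_fin.
by rewrite phim -EFinM (bigD1 i)//= mulrC.
Qed.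

(** * Second moment and symmetry of the centred Gaussian *)

Lemma normal_fun0E {R : realType} (s x : R) :
  normal_fun 0 s x = expR (- x ^+ 2 / (s ^+ 2 *+ 2)).
Proof. by rewrite /normal_fun subr0. Qed.

Lemma continuous_normal_fun0 {R : realType} (s : R) :
  continuous (normal_fun 0 s).
Proof.
move=> x; rewrite (_ : normal_fun 0 s =
  expR \o (fun x => - (x * x) * (s ^+ 2 *+ 2)^-1)); last first.
  by apply/funext => y; rewrite normal_fun0E expr2.
apply: continuous_comp; last exact: continuous_expR.
by apply: cvgMr_tmp; apply: cvgN; apply: cvgM.
Qed.

Lemma is_derive_normal_fun0 {R : realType} (s x : R) : s != 0 ->
  is_derive x 1 (normal_fun 0 s) (- (x / s ^+ 2) * normal_fun 0 s x).
Proof.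
move=> s0.
rewrite (_ : normal_fun 0 s =
  expR \o (fun x => (- (s ^+ 2 *+ 2)^-1) * x ^+ 2)); last first.
  by apply/funext => y; rewrite normal_fun0E/= mulrC mulrN mulNr.
apply: is_derive_eq; rewrite /GRing.scale/=.
by field.
Qed.

(** This is the boundary term of an integration by parts; [1 + t <= expR t] at $t = x^2/(2s^2)$
    bounds it by $2s^2/x$. *)
Lemma cvg_Mnormal_fun0 {R : realType} (s : R) : s != 0 ->
  (n%:R * normal_fun 0 s n%:R) @[n --> \oo] --> (0 : R).
Proof.
move=> s0; rewrite -cvg_shiftS/=.
apply: (@squeeze_cvgr _ _ _ _ (cst 0) (fun n => (s ^+ 2 *+ 2) * harmonic n)).
- near=> n; rewrite mulr_ge0 ?normal_fun_ge0//=.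
  rewrite normal_fun0E mulNr expRN.
  set x : R := n.+1%:R.
  have x0 : 0 < x by rewrite ltr0n.
  have s2 : 0 < s ^+ 2 *+ 2 by rewrite pmulrn_lgt0// exprn_even_gt0.
  rewrite /harmonic/= -/x ler_pdivrMr ?expR_gt0// mulrAC ler_pdivlMr//.
  rewrite -expr2 mulrC -ler_pdivrMr// (le_trans _ (expR_ge1Dx _))//.
  by rewrite lerDr.
- exact: cvg_cst.
- rewrite -(mulr0 (s ^+ 2 *+ 2)); apply: cvgMl_tmp; exact: cvg_harmonic.
Unshelve. all: by end_near. Qed.

(** Integration by parts on $[0,n]$, with [- s ^+ 2 * normal_fun 0 s] as primitive of
    [x * normal_fun 0 s x]; then $n\to\infty$. *)
Lemma integral_sqr_normal_fun0 {R : realType} (s : R) : s != 0 ->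
  (\int[lebesgue_measure]_(x in `[0%R, +oo[) (x ^+ 2 * normal_fun 0 s x)%:E =
   (s ^+ 2)%:E * \int[lebesgue_measure]_(x in `[0%R, +oo[)
     (normal_fun 0 s x)%:E)%E.
Proof.
move=> s0.
have parts n : (\int[lebesgue_measure]_(x in `[0%R, n%:R])
      (x ^+ 2 * normal_fun 0 s x)%:E =
    (- (s ^+ 2 * (n%:R * normal_fun 0 s n%:R)))%:E +
    (s ^+ 2)%:E * \int[lebesgue_measure]_(x in `[0%R, n%:R])
       (normal_fun 0 s x)%:E)%E.
  case: n => [|n].
    by rewrite set_itv1 !integral_set1 mul0r !mulr0 oppr0 mule0 adde0.
  pose F (x : R) := x; pose G (x : R) : R := - s ^+ 2 * normal_fun 0 s x.
  have dG (x : R) : is_derive x 1 G (x * normal_fun 0 s x).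
    have := is_derive_normal_fun0 s x s0 => dN.
    apply: is_derive_eq; rewrite /GRing.scale/=.
    by field.
  have cN := continuous_normal_fun0 s.
  have cG : continuous G by move=> x; apply: cvgMl_tmp; exact: cN.
  transitivity (\int[lebesgue_measure]_(x in `[0%R, n.+1%:R])
      (F x * (x * normal_fun 0 s x))%:E)%E.
    by apply: eq_integral => x _; rewrite /F mulrA expr2.
  rewrite (@integration_by_parts _ F G (cst 1) _ 0 n.+1%:R)//.
  - rewrite /F /G mul0r subr0; congr (_%:E + _)%E; first by ring.
    under eq_integral do rewrite /cst mul1r /G EFinM.
    rewrite integralZl//=; first by rewrite EFinN mulNe oppeK.
    apply: continuous_compact_integrable; first exact: segment_compact.
    exact: continuous_subspaceT.
  - exact/continuous_subspaceT/cst_continuous.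
  - split => //.
    + by apply: cvg_at_right_filter; exact: cvg_id.
    + by apply: cvg_at_left_filter; exact: cvg_id.
  - by move=> x _; rewrite derive1E derive_id.
  - apply: continuous_subspaceT => x.
    by apply: cvgM; [exact: cvg_id|exact: cN].
  - split => //.
    + by apply: cvg_at_right_filter; exact: cG.
    + by apply: cvg_at_left_filter; exact: cG.
  - by move=> x _; rewrite derive1E; apply: derive_val.
have N0 (x : R) : 0 <= normal_fun 0 s x by exact: normal_fun_ge0.
have mN := measurable_normal_fun 0 s.
have lim1 : (\int[lebesgue_measure]_(x in `[0%R, n%:R])
      (x ^+ 2 * normal_fun 0 s x)%:E @[n --> \oo] -->
    \int[lebesgue_measure]_(x in `[0%R, +oo[) (x ^+ 2 * normal_fun 0 s x)%:E)%E.
  apply: ge0_cvgn_integral.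
  - by move=> x; rewrite mulr_ge0 ?sqr_ge0.
  - by apply: measurable_funM.
have lim2 := @ge0_cvgn_integral _ lebesgue_measure _ N0 mN.
have lim0 : (- (s ^+ 2 * (n%:R * normal_fun 0 s n%:R))) @[n --> \oo] -->
    (0 : R).
  have := cvgN (cvgMl_tmp (a := s ^+ 2) (cvg_Mnormal_fun0 _ s0)).
  rewrite mulr0 oppr0; exact.
move: lim1; rewrite (funext parts) => lim1.
apply: (cvg_unique _ lim1 _) => //=.
rewrite -[X in _ --> X]add0e.
apply: cvgeD => //.
- by apply: cvg_EFin; [near=> n|exact: lim0].
- by apply: cvgeZl.
Unshelve. all: by end_near. Qed.

Lemma normal_second_moment {R : realType} (s : R) : s != 0 ->
  (\int[lebesgue_measure]_x (normal_pdf 0 s x * x ^+ 2)%:E = (s ^+ 2)%:E)%E.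
Proof.
move=> s0.
have N0 (x : R) : 0 <= normal_fun 0 s x by exact: normal_fun_ge0.
have cN := continuous_normal_fun0 s.
have evenN : normal_fun 0 s =1 normal_fun 0 s \o -%R.
  by move=> x; rewrite /= !normal_fun0E sqrrN.
have p0 : 0 <= normal_peak s by exact: normal_peak_ge0.
have mN := measurable_normal_fun 0 s.
transitivity ((normal_peak s)%:E *
    \int[lebesgue_measure]_x (x ^+ 2 * normal_fun 0 s x)%:E)%E.
  rewrite -ge0_integralZl_EFin//; last 2 first.
  - by move=> x _; rewrite lee_fin mulr_ge0 ?sqr_ge0.
  - by apply/measurable_EFinP; apply: measurable_funM.
  apply: eq_integral => x _; rewrite normal_pdfE// -EFinM; congr EFin.
  by rewrite /=; ring.
rewrite ge0_symfun_integralT; last 3 first.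
- by move=> x; rewrite mulr_ge0 ?sqr_ge0.
- by move=> x; apply: cvgM; [exact: exprn_continuous|exact: cN].
- by move=> x; rewrite /= sqrrN evenN.
rewrite -set_itvcy integral_sqr_normal_fun0//.
(* The half-line carries half of the total mass 1 of the density, so the Gaussian integral need not
   be evaluated. *)
have peak2 : (2%:E * ((normal_peak s)%:E *
    \int[lebesgue_measure]_(x in `[0%R, +oo[) (normal_fun 0 s x)%:E) = 1)%E.
  rewrite -(@integral_normal_pdf _ 0 s) [RHS]ge0_symfun_integralT.
  - rewrite -set_itvcy -ge0_integralZl_EFin//; first congr (_ * _)%E.
    + by apply: eq_integral => x _; rewrite normal_pdfE// EFinM.
    + by move=> x _; rewrite lee_fin.
    + exact/measurable_EFinP/measurable_funTS.
  - by move=> x; rewrite normal_pdf_ge0.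
  - exact: continuous_normal_pdf.
  - by move=> x; rewrite /= !normal_pdfE// evenN.
rewrite (muleCA 2%:E) (muleCA (normal_peak s)%:E) (muleCA (normal_peak s)%:E).
by rewrite peak2 mule1.
Qed.

(** The density is even and Lebesgue measure is invariant under reflection. This gives the positive
    and negative parts of a centred Gaussian the same mean. *)
Lemma integral_normal_pdf_symm {R : realType} (s : R) (f : R -> R) :
  s != 0 -> measurable_fun setT f -> (forall x, 0 <= f x) ->
  (\int[lebesgue_measure]_x (normal_pdf 0 s x * f (- x))%:E =
   \int[lebesgue_measure]_x (normal_pdf 0 s x * f x)%:E)%E.
Proof.
move=> s0 mf f0.
have evenp x : normal_pdf 0 s (- x) = normal_pdf 0 s x.
  by rewrite !normal_pdfE//= !normal_fun0E sqrrN.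
have mp := measurable_normal_pdf 0 s.
transitivity (\int[pushforward lebesgue_measure
    (-%R : R -> measurableTypeR R)]_x (normal_pdf 0 s x * f x)%:E)%E.
  rewrite ge0_integral_pushforward//=.
  - by rewrite preimage_setT; apply: eq_integral => x _; rewrite /= evenp.
  - by apply/measurable_EFinP; apply: measurable_funM.
  - by move=> x _; rewrite lee_fin mulr_ge0 ?normal_pdf_ge0.
by apply: eq_measure_integral => A mA _; exact: lebesgue_measureN.
Qed.

(** * Determinant expansions and a rank-one update *)

(** Multilinearity in the rows: distributing each Leibniz product selects one summand [f a] in every
    row. *)
Lemma det_matrix_sum {R : comPzRingType} {n} (K : finType)
    (E : 'I_n -> 'I_n -> K -> R) :
  \det (\matrix_(a, b) \sum_k E a b k) =
  \sum_(f : {ffun 'I_n -> K}) \det (\matrix_(a, b) E a b (f a)).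
Proof.
rewrite /determinant exchange_big/=; apply: eq_bigr => s _.
rewrite -big_distrr/=; congr (_ * _).
under eq_bigr do rewrite mxE.
rewrite bigA_distr_bigA; apply: eq_bigr => f _.
by apply: eq_bigr => a _; rewrite mxE.
Qed.

Lemma det_scale_rows_cols {R : comPzRingType} {n} (u v : 'I_n -> R)
    (M : 'I_n -> 'I_n -> R) :
  \det (\matrix_(a, b) (u a * v b * M a b)) =
  (\prod_a u a) * (\prod_a v a) * \det (\matrix_(a, b) M a b).
Proof.
rewrite /determinant big_distrr/=; apply: eq_bigr => s _.
rewrite mulrCA; congr (_ * _).
rewrite [\prod_a v a](reindex_inj (@perm_inj _ s)) -!big_split/=.
by apply: eq_bigr => a _; rewrite !mxE.
Qed.

(** Block unitriangular factors, of determinant 1, exchange $1 + uv$ for $1 + vu$, which is a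
    scalar. *)
Lemma det_rank1_update {R : comPzRingType} {n} (u : 'cV[R]_n) (v : 'rV[R]_n) :
  \det (1%:M + u *m v) = 1 + (v *m u) 0 0.
Proof.
have E : block_mx 1%:M 0 v 1%:M *m block_mx (1%:M + u *m v) u 0 1%:M *m
    block_mx 1%:M 0 (- v) 1%:M = block_mx 1%:M u 0 (1%:M + v *m u).
  rewrite !mulmx_block !(mul1mx, mulmx1, mul0mx, mulmx0, addr0, add0r).
  rewrite !mulmxN mulmxDl mulmxDr !mul1mx mulmx1 mulmxA.
  by rewrite addrK [v + _]addrC subrr [v *m u + _]addrC.
have := congr1 determinant E.
rewrite !det_mulmx !det_lblock !det_ublock !det1 !(mul1r, mulr1) => ->.
by rewrite det_mx11 !mxE.
Qed.

(** Rows outside [S] are rows of the identity, so this is $\det(J + xI)$ of size [#|S|], with $J$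
    all-ones. Dividing the rows in [S] by [x] leaves a rank-one perturbation of the identity. *)
Lemma det_scalar_add_ones {F : fieldType} {n} (S : {set 'I_n}) (x : F) :
  x != 0 ->
  \det (\matrix_(a, b) (if a \in S then 1 + x *+ (a == b) else (a == b)%:R)) =
  x ^+ #|S| * (1 + #|S|%:R / x).
Proof.
move=> x0.
pose D a := if a \in S then x else 1.
pose u : 'cV[F]_n := \col_a (if a \in S then x^-1 else 0).
pose v : 'rV[F]_n := const_mx 1.
transitivity (\det (\matrix_(a, b) (D a * 1 * (1%:M + u *m v) a b))).
  congr determinant; apply/matrixP => a b; rewrite !mxE big_ord1 !mxE /D.
  case: ifP => _; rewrite !mulr1 ?addr0 ?mul1r//.
  by rewrite mulrDr mulfV// [RHS]addrC mulr_natr.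
rewrite det_scale_rows_cols big1_eq mulr1.
rewrite (_ : \matrix_(a, b) _ = 1%:M + u *m v); last first.
  by apply/matrixP => a b; rewrite !mxE.
rewrite det_rank1_update; congr (_ * (_ + _)).
  by rewrite /D -big_mkcond/= prodr_const.
rewrite mxE; under eq_bigr do rewrite !mxE mul1r.
by rewrite -big_mkcond/= sumr_const mulr_natl.
Qed.

(** * Positivity of Gram determinants *)

Section Gram.
Context {R : rcfType} {n : nat} (K : finType) (B : 'I_n -> K -> R[i]).

Let gram := \det (\matrix_(a, b) \sum_k (B a k * conjc (B b k))).
Let minor (f : {ffun 'I_n -> K}) := \det (\matrix_(a, b) B a (f b)).

(** Cauchy-Binet over all maps [f]: a non-injective [f] has zero minor, and each set of $n$ columns
    is met in $n!$ orders, whence the multiple. *)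
Lemma det_gram : gram *+ n`! = \sum_f minor f * conjc (minor f).
Proof.
have gramE : gram =
    \sum_(f : {ffun _ -> _}) (\prod_a B a (f a)) * conjc (minor f).
  rewrite /gram det_matrix_sum; apply: eq_bigr => f _.
  transitivity (\det (\matrix_(a, b) (B a (f a) * 1 * conjc (B b (f a))))).
    by congr determinant; apply/matrixP => a b; rewrite !mxE mulr1.
  rewrite det_scale_rows_cols big1_eq mulr1; congr (_ * _).
  rewrite /minor -det_map_mx -det_tr; congr determinant.
  by apply/matrixP => a b; rewrite !mxE.
(* Averaging over the reindexings of [f] by permutations turns the product of
   entries in [gramE] into a determinant. *)
have permE (t : 'S_n) : gram =
    \sum_(f : {ffun _ -> _})
      ((-1) ^+ t * \prod_a B a (f (t a))) * conjc (minor f).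
  pose h (f : {ffun 'I_n -> K}) : {ffun 'I_n -> K} := [ffun a => f (t a)].
  have hK : cancel h (fun f : {ffun 'I_n -> K} => [ffun a => f ((t^-1)%g a)]).
    by move=> f; apply/ffunP => a; rewrite !ffunE permKV.
  rewrite gramE (reindex_inj (can_inj hK)); apply: eq_bigr => f _.
  (* Precomposing [f] with [t] permutes the columns of the minor, which costs the sign of [t]. *)
  have -> : minor (h f) = (-1) ^+ t * minor f.
    rewrite /minor -det_tr -[in RHS]det_tr -det_perm -det_mulmx -row_permE.
    by congr determinant; apply/matrixP => a b; rewrite !mxE ffunE.
  rewrite rmorphM/= rmorph_sign mulrA mulrAC mulrC mulrA; congr (_ * _ * _).
  by apply: eq_bigr => a _; rewrite ffunE.
have -> : n`! = #|'S_n| by rewrite card_Sn.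
rewrite -sumr_const (eq_bigr _ (fun t _ => permE t)) exchange_big/=.
apply: eq_bigr => f _; rewrite -big_distrl/=; congr (_ * _).
by apply: eq_bigr => t _; congr (_ * _); apply: eq_bigr => a _; rewrite mxE.
Qed.

(** Every summand in [det_gram] is a squared modulus, so one nonzero minor makes the sum
    positive. *)
Lemma det_gram_gt0 (f : {ffun 'I_n -> K}) : minor f != 0 -> 0 < gram.
Proof.
move=> f0; have n0 : (0 < n`!)%N by exact: fact_gt0.
rewrite -(pmulrn_lgt0 _ n0) det_gram (bigD1 f)//=.
have sqr_ge0 (z : R[i]) : 0 <= z * conjc z.
  by rewrite -normCK exprn_ge0.
apply: ltr_wpDr; first by apply: sumr_ge0.
by rewrite lt_def sqr_ge0 mulf_neq0// fmorph_eq0.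
Qed.

End Gram.

(** * Counting partial injections *)

Definition psupport {n m : nat} (f : {ffun 'I_n -> option 'I_m}) : {set 'I_n} :=
  [set a | f a != None]%SET.

(** Enumerating [S] identifies these maps with the injections from ['I_#|S|] to ['I_m]; outside [S]
    they are forced to be [None]. *)
Lemma card_pinj {n m : nat} (S : {set 'I_n}) :
  #|[set f : {ffun 'I_n -> option 'I_m} |
      psupport f == S & dinjectiveb f (psupport f)]%SET| =
  m ^_ #|S|.
Proof.
rewrite -[in RHS](card_ord #|S|) -[in RHS](card_ord m) -card_inj_ffuns.
pose F (h : {ffun 'I_#|S| -> 'I_m}) : {ffun 'I_n -> option 'I_m} :=
  [ffun a => omap h [pick i | enum_val i == a]].
have FE h i : F h (enum_val i) = Some (h i).
  rewrite ffunE; case: pickP => [j /eqP/enum_val_inj->//|/(_ i)].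
  by rewrite eqxx.
have FN h a : a \notin S -> F h a = None.
  move=> aS; rewrite ffunE; case: pickP => // j /eqP ja.
  by move: (enum_valP j); rewrite ja (negbTE aS).
have Finj : injective F.
  move=> h1 h2 eqF; apply/ffunP => i.
  by have := FE h1 i; rewrite eqF FE => -[].
have Fsupp h : psupport (F h) = S.
  apply/setP => a; rewrite inE.
  have [aS|/FN->//] := boolP (a \in S).
  by rewrite -(enum_rankK_in aS aS) FE.
rewrite -(card_imset _ Finj); apply: eq_card => f; rewrite inE.
apply/andP/imsetP => [[/eqP fS /dinjectiveP finj]|[h]].
  have fSome (i : 'I_#|S|) : exists k, f (enum_val i) == Some k.
    have : enum_val i \in psupport f by rewrite fS enum_valP.
    by rewrite inE; case: (f _) => // k _; exists k.
  pose h := [ffun i : 'I_#|S| => xchoose (fSome i)].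
  have hE i : f (enum_val i) = Some (h i).
    by rewrite ffunE; apply/eqP; exact: (xchooseP (fSome i)).
  exists h.
    rewrite inE; apply/injectiveP => i j hij.
    suff /enum_val_inj : enum_val i = enum_val j by [].
    by apply: finj; rewrite ?fS ?enum_valP// !hE hij.
  apply/ffunP => a; have [aS|aS] := boolP (a \in S).
    by rewrite -(enum_rankK_in aS aS) FE hE.
  by rewrite FN//; move: aS; rewrite -fS inE negbK => /eqP.
rewrite inE => /injectiveP hinj ->; split; first by rewrite Fsupp.
apply/dinjectiveP; rewrite Fsupp => a b aS bS.
rewrite -(enum_rankK_in aS aS) -(enum_rankK_in bS bS) !FE => -[/hinj ab].
by congr enum_val.
Qed.

(** Partial injections are grouped by support, then supports by cardinality; [m ^_ k] stands for
    $\binom{m}{k}k!$. *)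
Lemma sum_pinj {V : nmodType} {n m : nat} (G : nat -> V) :
  \sum_(f : {ffun 'I_n -> option 'I_m} |
      dinjectiveb f (psupport f)) G #|psupport f| =
  \sum_(k < n.+1) G k *+ ('C(n, k) * (m ^_ k)).
Proof.
rewrite (partition_big (@psupport n m) predT)//=.
transitivity (\sum_(S : {set 'I_n}) G #|S| *+ (m ^_ #|S|)).
  apply: eq_bigr => S _; rewrite -card_pinj -sumr_const.
  rewrite [RHS](eq_bigl (fun f : {ffun 'I_n -> option 'I_m} =>
    dinjectiveb f (psupport f) && (psupport f == S))).
    by apply: eq_bigr => f /andP[_ /eqP->].
  by move=> f; rewrite inE andbC.
(* [inord] loses nothing, since a subset of ['I_n] has at most [n] elements. *)
rewrite (partition_big (fun S : {set 'I_n} => inord #|S| : 'I_n.+1) predT)//=.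
apply: eq_bigr => k _.
have cardS (S : {set 'I_n}) : (inord #|S| == k :> 'I_n.+1) = (#|S| == k).
  rewrite -val_eqE/= inordK// ltnS.
  by rewrite (leq_trans (max_card _))// card_ord.
rewrite (eq_bigr (fun _ => G k *+ (m ^_ k))) => [|S]; last first.
  by rewrite cardS => /eqP->.
rewrite (eq_bigl (fun S : {set 'I_n} =>
    S \in [set S : {set 'I_n} | #|S| == k]%SET)).
  by rewrite sumr_const card_draws card_ord mulnC mulrnA.
by move=> S; rewrite inE cardS.
Qed.

(** * Means of real and complex random variables *)

(** Integrability is bundled with the value, so that means add and scale without side conditions. *)
Definition has_mean {d} {T : measurableType d} {R : realType}
    (P : probability T R) (f : T -> R) (m : R) : Prop :=
  P.-integrable setT (EFin \o f) /\ (\int[P]_w (f w)%:E = m%:E)%E.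

(** Both components are tracked because multiplication by a complex constant mixes them. *)
Definition has_cmean {d} {T : measurableType d} {R : realType}
    (P : probability T R) (Z : T -> R[i]) (z : R[i]) : Prop :=
  has_mean P (fun w => complex.Re (Z w)) (complex.Re z) /\
  has_mean P (fun w => complex.Im (Z w)) (complex.Im z).

Section Mean.
Context {d} {T : measurableType d} {R : realType} (P : probability T R).

Lemma has_meanD f g a b : has_mean P f a -> has_mean P g b ->
  has_mean P (fun w => f w + g w) (a + b).
Proof.
move=> [if_ fa] [ig gb]; split.
  by have := integrableD measurableT if_ ig.
under eq_integral do rewrite EFinD.
by rewrite integralD// fa gb.
Qed.

Lemma has_meanZ c f a : has_mean P f a ->
  has_mean P (fun w => c * f w) (c * a).
Proof.
move=> [if_ fa]; split; first by have := integrableZl measurableT c if_.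
under eq_integral do rewrite EFinM.
by rewrite integralZl// fa.
Qed.

Lemma has_mean0 : has_mean P (fun=> 0) 0.
Proof.
split; first exact: integrable0.
by rewrite integral0.
Qed.

Lemma has_mean_ge0 (f : T -> R) m :
  measurable_fun setT f -> (forall w, 0 <= f w) ->
  (\int[P]_w (f w)%:E = m%:E)%E -> has_mean P f m.
Proof.
move=> mf f0 fm; split=> //; apply/integrableP; split.
  exact/measurable_EFinP.
under eq_integral do rewrite /= ger0_norm//.
by rewrite fm ltry.
Qed.

Lemma has_cmean_real f m : has_mean P f m ->
  has_cmean P (fun w => (f w)%:C%C) m%:C%C.
Proof. by move=> fm; split => //; exact: has_mean0. Qed.

Lemma has_cmean0 : has_cmean P (fun=> 0) 0.
Proof. by split; exact: has_mean0. Qed.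

Lemma has_cmeanD Y Z y z : has_cmean P Y y -> has_cmean P Z z ->
  has_cmean P (fun w => Y w + Z w) (y + z).
Proof.
move=> [rY iY] [rZ iZ]; split.
- rewrite (_ : (fun w => _) = fun w => complex.Re (Y w) + complex.Re (Z w)).
    by rewrite raddfD; exact: has_meanD.
  by apply/funext => w; rewrite raddfD.
- rewrite (_ : (fun w => _) = fun w => complex.Im (Y w) + complex.Im (Z w)).
    by rewrite raddfD; exact: has_meanD.
  by apply/funext => w; rewrite raddfD.
Qed.

Lemma has_cmeanZ c Z z : has_cmean P Z z ->
  has_cmean P (fun w => c * Z w) (c * z).
Proof.
case: c => a b [rZ iZ]; split.
- rewrite (_ : (fun w => _) =
    fun w => a * complex.Re (Z w) + (- b) * complex.Im (Z w)).
    rewrite (_ : complex.Re _ = a * complex.Re z + (- b) * complex.Im z).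
      by apply: has_meanD; exact: has_meanZ.
    by case: z {rZ iZ} => x y /=; rewrite mulNr.
  by apply/funext => w; case: (Z w) => x y /=; rewrite mulNr.
- rewrite (_ : (fun w => _) =
    fun w => a * complex.Im (Z w) + b * complex.Re (Z w)).
    rewrite (_ : complex.Im _ = a * complex.Im z + b * complex.Re z).
      by apply: has_meanD; exact: has_meanZ.
    by case: z {rZ iZ} => x y.
  by apply/funext => w; case: (Z w) => x y.
Qed.

Lemma has_cmean_sum (I : Type) (s : seq I) (Q : pred I) (Z : I -> T -> R[i])
    (z : I -> R[i]) : (forall i, Q i -> has_cmean P (Z i) (z i)) ->
  has_cmean P (fun w => \sum_(i <- s | Q i) Z i w) (\sum_(i <- s | Q i) z i).
Proof.
move=> Zz; elim: s => [|i s IH].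
  by rewrite big_nil; under eq_fun do rewrite big_nil; exact: has_cmean0.
rewrite big_cons; under eq_fun do rewrite big_cons.
by case: ifP => // Qi; apply: has_cmeanD => //; exact: Zz.
Qed.

(** Expanding the product of sums leaves, for each choice of one [e] per index, a complex constant
    times a product of nonnegative functions of independent variables. *)
Lemma has_cmean_prod_indep (I E : finType) (X : I -> {RV P >-> R})
    (phi : E -> R -> R) (m : E -> R) (c : I -> E -> R[i]) :
  mutually_independent_RVs X ->
  (forall e, measurable_fun setT (phi e)) -> (forall e x, 0 <= phi e x) ->
  (forall i e, (\int[P]_w (phi e (X i w))%:E = (m e)%:E)%E) ->
  has_cmean P (fun w => \prod_i \sum_e c i e * (phi e (X i w))%:C%C)
    (\prod_i \sum_e c i e * (m e)%:C%C).
Proof.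
move=> indX mphi phi0 phim.
have prodE (x : I -> E -> R) : \prod_i \sum_e c i e * (x i e)%:C%C =
    \sum_(f : {ffun I -> E}) (\prod_i c i (f i)) *
       (\prod_i x i (f i))%:C%C.
  rewrite bigA_distr_bigA; apply: eq_bigr => f _.
  by rewrite big_split/= rmorph_prod.
rewrite (prodE (fun=> m)).
under eq_fun => w do rewrite (prodE (fun i e => phi e (X i w))).
apply: has_cmean_sum => f _; apply: has_cmeanZ; apply: has_cmean_real.
apply: has_mean_ge0.
- apply: measurable_prod => i _.
  by apply: measurableT_comp => //; exact: measurable_funPT.
- by move=> w; exact: prodr_ge0.
- exact: (ge0_integral_prod_indep _ _ _ (fun i => phi (f i)) _ indX).
Qed.

End Mean.

(** * Products of the factors $1 \pm jX$ for independent Gaussians *)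

Section GaussianFactors.
Context {d} {T : measurableType d} {R : realType} (P : probability T R).
Variables (I : finType) (X : I -> {RV P >-> R}) (s2 : R).
Hypothesis s2_gt0 : 0 < s2.
Hypothesis indX : mutually_independent_RVs X.
Hypothesis X_normal : forall i A, measurable A ->
  distribution P (X i) A = normal_prob 0 (Num.sqrt s2) A.

Let s := Num.sqrt s2.
Let s_neq0 : s != 0. Proof. by rewrite gt_eqF// sqrtr_gt0. Qed.

Lemma integral_normal_RV i (f : R -> R) :
  measurable_fun setT f -> (forall x, 0 <= f x) ->
  (\int[P]_w (f (X i w))%:E =
   \int[lebesgue_measure]_x (normal_pdf 0 s x * f x)%:E)%E.
Proof.
move=> mf f0.
have mfE : measurable_fun setT (EFin \o f) by exact/measurable_EFinP.
have fE0 y : (0 <= (EFin \o f) y)%E by rewrite lee_fin.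
transitivity (\int[distribution P (X i)]_y (f y)%:E)%E.
  by rewrite (ge0_integral_distribution (X i) mfE fE0).
rewrite (ge0_integral_density lebesgue_measure (distribution P (X i))
  (normal_pdf 0 s) idfun _ _ _ _ (EFin \o f))//=.
- exact: measurable_normal_pdf.
- by move=> x; exact: normal_pdf_ge0.
- exact: measurable_id.
- by move=> B mB; exact: X_normal.
Qed.

Let pos_part (x : R) : R := Num.max x 0.
Let mpos : measurable_fun setT pos_part.
Proof. exact: measurable_maxr. Qed.

(** Only a common finite value matters: the two means will enter with opposite coefficients and
    cancel. *)
Let gaussian_factor_mean : exists m : R, forall i,
  (\int[P]_w (pos_part (X i w))%:E = m%:E)%E /\
  (\int[P]_w (pos_part (- X i w))%:E = m%:E)%E.
Proof.
set I0 := (\int[lebesgue_measure]_x (normal_pdf 0 s x * pos_part x)%:E)%E.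
have pos0 x : 0 <= pos_part x by rewrite /pos_part le_max lexx orbT.
have I0E i : (\int[P]_w (pos_part (X i w))%:E = I0)%E.
  exact: integral_normal_RV.
have I0NE i : (\int[P]_w (pos_part (- X i w))%:E = I0)%E.
  rewrite (integral_normal_RV i (fun x => pos_part (- x)))//.
    exact: integral_normal_pdf_symm.
  exact: measurableT_comp.
exists (fine I0) => i; rewrite I0E I0NE fineK//.
have I0_ge0 : (0 <= I0)%E.
  by apply: integral_ge0 => x _; rewrite lee_fin mulr_ge0// normal_pdf_ge0.
rewrite ge0_fin_numE//.
have mpdf := measurable_normal_pdf 0 s.
(* Finiteness comes from $\max(x,0) \le 1 + x^2$, whose right side has a known Gaussian mean. *)
apply: (@le_lt_trans _ _ (\int[lebesgue_measure]_x
    ((normal_pdf 0 s x)%:E + (normal_pdf 0 s x * x ^+ 2)%:E))%E).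
  apply: ge0_le_integral => //.
  - by move=> x _; rewrite lee_fin mulr_ge0// normal_pdf_ge0.
  - by apply/measurable_EFinP; exact: measurable_funM.
  - apply: emeasurable_funD; first exact/measurable_EFinP.
    by apply/measurable_EFinP; apply: measurable_funM.
  - move=> x _; rewrite -EFinD lee_fin -{2}[normal_pdf 0 s x]mulr1 -mulrDr.
    rewrite ler_wpM2l ?normal_pdf_ge0// /pos_part ge_max.
    by apply/andP; split; nra.
rewrite ge0_integralD//; last 4 first.
- by move=> x _; rewrite lee_fin normal_pdf_ge0.
- exact/measurable_EFinP.
- by move=> x _; rewrite lee_fin mulr_ge0 ?normal_pdf_ge0 ?sqr_ge0.
- by apply/measurable_EFinP; apply: measurable_funM.
by rewrite integral_normal_pdf normal_second_moment// -EFinD ltry.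
Qed.

(** A lone factor $1 \pm jX$ has mean 1 since $X$ is centred; the pair multiplies to $1 + X^2$, of
    mean $1 + \sigma^2$. *)
Lemma has_cmean_prod_gaussian (p q : pred I) :
  has_cmean P
    (fun w => \prod_i ((if p i then 1 + 'i%C * (X i w)%:C%C else 1) *
                       (if q i then 1 - 'i%C * (X i w)%:C%C else 1)))
    (\prod_i (if p i && q i then 1 + s2%:C%C else 1)).
Proof.
have [m mE] := gaussian_factor_mean.
(* Independence is available for nonnegative functions only, so each factor is
   expanded over [1], [x^+], [x^-] and [x^2]. *)
pose phi (e : 'I_4) (x : R) : R :=
  nth 0 [:: 1; pos_part x; pos_part (- x); x ^+ 2] e.
pose mu (e : 'I_4) : R := nth 0 [:: 1; m; m; s2] e.
(* With [p], [q] read as 0 or 1, $(1 + jpx)(1 - jqx) = 1 + j(p-q)x + pqx^2$; [k i] is the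
   coefficient of $x = x^+ - x^-$. *)
pose k i : R[i] := 'i%C * ((p i)%:R - (q i)%:R).
pose c i (e : 'I_4) : R[i] := nth 0 [:: 1; k i; - k i; (p i && q i)%:R] e.
have := @has_cmean_prod_indep _ _ _ P I 'I_4 X phi mu c indX.
have -> : (fun w => \prod_i \sum_e c i e * (phi e (X i w))%:C%C) =
    (fun w => \prod_i ((if p i then 1 + 'i%C * (X i w)%:C%C else 1) *
                       (if q i then 1 - 'i%C * (X i w)%:C%C else 1))).
  apply/funext => w; apply: eq_bigr => i _.
  rewrite !big_ord_recl big_ord0 /c /phi /=.
  set x := X i w.
  have xE : x = pos_part x - pos_part (- x).
    by rewrite /pos_part !maxEle; do 2 case: ifP; lra.
  have -> : 'i%C * x%:C%C = 'i%C * ((pos_part x)%:C%C - (pos_part (- x))%:C%C).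
    by rewrite {1}xE rmorphB.
  (* Writing $x^2$ as $-(jx)^2$ leaves an identity that holds without using $j^2 = -1$. *)
  have -> : (x ^+ 2)%:C%C = - ('i%C * x%:C%C) ^+ 2.
    by rewrite exprMn sqr_i rmorphXn; ring.
  rewrite {3}xE rmorphB/= /k.
  by case: (p i); case: (q i); rewrite /=; ring.
have -> : \prod_i \sum_e c i e * (mu e)%:C%C =
    \prod_i (if p i && q i then 1 + s2%:C%C else 1).
  apply: eq_bigr => i _.
  rewrite !big_ord_recl big_ord0 /c /mu /=.
  by case: (p i && q i); rewrite ?mul1r ?mul0r; ring.
apply.
- case=> [[|[|[|[|//]]]] ?]; rewrite /phi/=.
  + exact: measurable_cst.
  + exact: mpos.
  + exact: measurableT_comp.
  + by apply: measurable_funX.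
- case=> [[|[|[|[|//]]]] ?] x; rewrite /phi/= ?ler01 ?sqr_ge0//.
  + by rewrite /pos_part le_max lexx orbT.
  + by rewrite /pos_part le_max lexx orbT.
- move=> i; case=> [[|[|[|[|//]]]] ?]; rewrite /phi /mu/=.
  + by rewrite (integral_cst P measurableT 1) mul1e; exact: probability_setT.
  + by case: (mE i).
  + by case: (mE i).
  + rewrite (integral_normal_RV i (fun x => x ^+ 2)).
    * by rewrite normal_second_moment// sqr_sqrtr// ltW.
    * exact: measurable_funX.
    * by move=> x; exact: sqr_ge0.
Qed.

End GaussianFactors.

(** * The expected determinant *)

Lemma big_option_type {V : Type} {idx : V} (op : Monoid.com_law idx)
    (K : finType) (F : option K -> V) :
  \big[op/idx]_o F o = op (F None) (\big[op/idx]_k F (Some k)).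
Proof.
rewrite (bigD1 None)//=; congr (op _ _).
rewrite (reindex_omap Some id) => [|[k|]//]; apply: eq_bigl => k /=.
by rewrite eqxx.
Qed.

Section ExpectedDet.
Context {d} {T : measurableType d} {R : realType} (P : probability T R).
Variables (n m : nat) (Phi : 'I_n * 'I_m -> {RV P >-> R}) (s2 : R).
Hypothesis s2_gt0 : 0 < s2.
Hypothesis indPhi : mutually_independent_RVs Phi.
Hypothesis Phi_normal : forall ij A, measurable A ->
  distribution P (Phi ij) A = normal_prob 0 (Num.sqrt s2) A.

(** These are the entries of $\hat{\mathbf H}$ with the unimodular factors removed. *)
Definition noisy_one w i j : R[i] := 1 + 'i%C * (Phi (i, j) w)%:C%C.

Local Notation A := noisy_one.

(* Row [i] of [selected_entry w f] is the [i]-th row of the identity if [f i] is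
   [None], and the [k]-th summand of row [i] of [A A^H] if [f i = Some k]. *)
Definition selected_entry w (f : {ffun 'I_n -> option 'I_m}) i b : R[i] :=
  if f i is Some k then A w i k * conjc (A w b k) else (i == b)%:R.

Local Notation selected := selected_entry.

Lemma conj_noisy_one w i j : conjc (A w i j) = 1 - 'i%C * (Phi (i, j) w)%:C%C.
Proof.
apply/eqP; rewrite /noisy_one eq_complex /=.
by apply/andP; split; apply/eqP; ring.
Qed.

Lemma det_selected_noninj w (f : {ffun 'I_n -> option 'I_m}) :
  ~~ dinjectiveb f (psupport f) ->
  \det (\matrix_(i, b) selected w f i b) = 0.
Proof.
case/dinjectivePn => i iS [j /andP[/= ji jS] fij].
(* [u] collects the row scalars; once they are removed, two rows selecting the same column [k]
   coincide. *)
pose u i : R[i] := if f i is Some k then A w i k else 1.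
pose M i b : R[i] := if f i is Some k then conjc (A w b k) else (i == b)%:R.
rewrite (_ : \matrix_(_, _) _ = \matrix_(i, b) (u i * 1 * M i b)); last first.
  apply/matrixP => a b; rewrite !mxE /selected_entry /u /M mulr1.
  by case: (f a) => [k//|]; rewrite mul1r.
rewrite det_scale_rows_cols (determinant_alternate ji) ?mulr0// => b.
rewrite !mxE /M -fij; move: iS; rewrite inE.
by case: (f i).
Qed.

(** The two Leibniz expansions are matched permutation by permutation: the mean of each product is
    the corresponding product for $J + \sigma^2 I$. *)
Lemma has_cmean_det_selected (f : {ffun 'I_n -> option 'I_m}) :
  dinjectiveb f (psupport f) ->
  has_cmean P (fun w => \det (\matrix_(i, b) selected w f i b))
    (s2 ^+ #|psupport f| * (1 + #|psupport f|%:R / s2))%:C%C.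
Proof.
move=> /dinjectiveP finj; set S := psupport f.
have -> : (s2 ^+ #|S| * (1 + #|S|%:R / s2))%:C%C = \det (\matrix_(a, b)
    (if a \in S then 1 + s2%:C%C *+ (a == b) else (a == b)%:R)).
  rewrite det_scalar_add_ones; last first.
    by rewrite fmorph_eq0 gt_eqF.
  by rewrite rmorphM rmorphXn rmorphD rmorph1 rmorphM/= fmorphV rmorph_nat.
have inS i : (i \in S) = (f i != None) by rewrite /S inE.
apply: has_cmean_sum => s _; apply: has_cmeanZ.
(* In the term of [s], [p] marks the entries of [Phi] occurring through $1 + j\Phi$, and [q] those
   occurring through the conjugate, which sits in row [s i] for a selected row [i]. *)
pose p (ij : 'I_n * 'I_m) := f ij.1 == Some ij.2.
pose q (ij : 'I_n * 'I_m) := f ((s^-1)%g ij.1) == Some ij.2.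
pose c : R[i] := \prod_(i | i \notin S) (i == s i)%:R.
have pick (V : comPzRingType) (F : 'I_n -> 'I_m -> V) (o : option 'I_m) i :
    \prod_j (if o == Some j then F i j else 1) =
    if o is Some k then F i k else 1.
  case: o => [k|]; last by rewrite big1.
  by rewrite -big_mkcond/= (eq_bigl (pred1 k)) ?big_pred1_eq.
have -> : (fun w => \prod_i (\matrix_(i, b) selected w f i b) i (s i)) =
    (fun w => c * \prod_ij
      ((if p ij then 1 + 'i%C * (Phi ij w)%:C%C else 1) *
       (if q ij then 1 - 'i%C * (Phi ij w)%:C%C else 1))).
  apply/funext => w.
  rewrite big_split/=.
  have -> : \prod_ij (if p ij then 1 + 'i%C * (Phi ij w)%:C%C else 1) =
      \prod_i (if f i is Some k then A w i k else 1).
    transitivity (\prod_i \prod_j (if f i == Some j then A w i j else 1)).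
      by rewrite pair_bigA/=; apply: eq_bigr => -[i j] _.
    by apply: eq_bigr => i _; rewrite pick.
  have -> : \prod_ij (if q ij then 1 - 'i%C * (Phi ij w)%:C%C else 1) =
      \prod_i (if f i is Some k then conjc (A w (s i) k) else 1).
    transitivity (\prod_i \prod_j
        (if f ((s^-1)%g i) == Some j then conjc (A w i j) else 1)).
      rewrite pair_bigA; apply: eq_bigr => ij _.
      by rewrite conj_noisy_one -surjective_pairing.
    rewrite [LHS](reindex_inj (@perm_inj _ s))/=; apply: eq_bigr => i _.
    by rewrite (pick _ (fun i j => conjc (A w i j))) permK.
  rewrite /c [X in X * _]big_mkcond/= -!big_split/=; apply: eq_bigr => i _.
  rewrite mxE /selected_entry inS; case: (f i) => [k|]; first by rewrite mul1r.
  by rewrite /= !mulr1.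
have -> : \prod_i (\matrix_(a, b)
      (if a \in S then 1 + s2%:C%C *+ (a == b) else (a == b)%:R)) i (s i) =
    c * \prod_ij (if p ij && q ij then 1 + s2%:C%C else 1).
  have -> : \prod_ij (if p ij && q ij then 1 + s2%:C%C else 1) =
      \prod_i (if (i \in S) && (i == s i) then 1 + s2%:C%C else 1 : R[i]).
    transitivity (\prod_i \prod_j (if f i == Some j then
        (if q (i, j) then 1 + s2%:C%C else 1) else 1 : R[i])).
      rewrite pair_bigA/=; apply: eq_bigr => -[i j] _.
      by rewrite /p/=; case: (f i == Some j).
    apply: eq_bigr => i _.
    rewrite (pick _ (fun i j => if q (i, j) then 1 + s2%:C%C else 1)).
    rewrite inS; case fi: (f i) => [k|//]; rewrite /q/= -fi.
    congr (if _ then _ else _).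
    (* Both factors meet at [(i, k)] only if [f] agrees at [i] and its preimage under [s];
       injectivity on the support then makes [i] a fixed point. *)
    apply/eqP/eqP => [E|si]; last by rewrite {1}si permK.
    suff si : (s^-1)%g i = i by rewrite -[in RHS]si permKV.
    by apply: finj; rewrite ?inE ?E ?fi.
  rewrite /c [X in X * _]big_mkcond/= -big_split/=; apply: eq_bigr => i _.
  rewrite mxE; case: (i \in S); case: (i == s i) => /=;
    by rewrite ?mul1r ?mulr1 ?addr0.
by apply: has_cmeanZ; exact: has_cmean_prod_gaussian.
Qed.

Lemma has_cmean_det (c : R) :
  has_cmean P
    (fun w => \det (\matrix_(a, b)
      ((a == b)%:R + \sum_k c%:C%C * (A w a k * conjc (A w b k)))))
    (\sum_(k < n.+1) (c ^+ k * s2 ^+ k * (1 + k%:R / s2))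
        *+ ('C(n, k) * (m ^_ k)))%:C%C.
Proof.
pose G k := (c ^+ k * s2 ^+ k * (1 + k%:R / s2)).
(* The sum over partial injections is extended by zero to all maps, for a termwise comparison. *)
rewrite -(sum_pinj G) rmorph_sum/= [X in has_cmean _ _ X]big_mkcond/=.
have -> : (fun w => \det (\matrix_(a, b)
      ((a == b)%:R + \sum_k c%:C%C * (A w a k * conjc (A w b k))))) =
    (fun w => \sum_(f : {ffun 'I_n -> option 'I_m})
       c%:C%C ^+ #|psupport f| * \det (\matrix_(i, b) selected w f i b)).
  apply/funext => w.
  (* The identity entry becomes the summand indexed by [None], so that row multilinearity
     applies. *)
  transitivity (\det (\matrix_(a, b) \sum_(o : option 'I_m)
      (if o is Some k then c%:C%C * (A w a k * conjc (A w b k))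
       else (a == b)%:R))).
    by congr determinant; apply/matrixP => a b; rewrite !mxE big_option_type.
  rewrite det_matrix_sum; apply: eq_bigr => f _.
  rewrite (_ : \matrix_(_, _) _ = \matrix_(a, b)
      ((if a \in psupport f then c%:C%C else 1) * 1 * selected w f a b)).
    by rewrite det_scale_rows_cols big1_eq mulr1 -big_mkcond/= prodr_const.
  apply/matrixP => a b; rewrite !mxE /selected_entry inE mulr1.
  by case: (f a) => [k//|]; rewrite mul1r.
apply: has_cmean_sum => f _; case: ifP => [finj|/negbT finj].
  rewrite /G -mulrA rmorphM rmorphXn/=.
  by apply: has_cmeanZ; exact: has_cmean_det_selected.
under eq_fun do rewrite det_selected_noninj// mulr0.
exact: has_cmean0.
Qed.

End ExpectedDet.

(** * Positivity of the determinant and Jensen's inequality *)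

(** This is the Gram determinant of the rows of $[\,I \mid \sqrt{c}\,A\,]$, and the identity block
    provides a nonzero minor. *)
Lemma det_1_add_gram_gt0 {R : rcfType} {n m : nat} (c : R)
    (A : 'M[R[i]]_(n, m)) :
  0 <= c -> 0 < \det (1%:M + c%:C%C *: (A *m ctrmx A)).
Proof.
move=> c0.
pose B (a : 'I_n) (k : 'I_n + 'I_m) : R[i] :=
  match k with inl b => (a == b)%:R | inr k => (Num.sqrt c)%:C%C * A a k end.
have -> : 1%:M + c%:C%C *: (A *m ctrmx A) =
    \matrix_(a, b) \sum_k (B a k * conjc (B b k)).
  apply/matrixP => a b; rewrite !mxE big_sumType/=; congr (_ + _).
    rewrite (bigD1 a)//= eqxx mul1r conjc_nat eq_sym big1 ?addr0// => k.
    by rewrite eq_sym => /negbTE->; rewrite mul0r.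
  rewrite big_distrr/=; apply: eq_bigr => k _; rewrite !mxE.
  have conjM (x y : R[i]) : conjc (x * y) = conjc x * conjc y by exact: rmorphM.
  by rewrite conjM conjc_real mulrACA -expr2 -rmorphXn sqr_sqrtr.
apply: (@det_gram_gt0 _ _ _ B [ffun a => inl a]).
rewrite (_ : \matrix_(_, _) _ = 1%:M) ?det1 ?oner_eq0//.
by apply/matrixP => a b; rewrite !mxE ffunE.
Qed.

Lemma expectation_log2_le {d} {T : measurableType d} {R : realType}
    (P : probability T R) (Y : T -> R) (m : R) :
  (forall w, 0 < Y w) -> 0 < m -> has_mean P Y m ->
  ('E_P[fun w => log2 (Y w)] <= (log2 m)%:E)%E.
Proof.
move=> Y0 m_gt0 Ym; have [iY EY] := Ym.
have mY : measurable_fun setT Y by move/integrableP : iY => [/measurable_EFinP].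
have ln2 : 0 < ln 2 :> R by rewrite ln_gt0// ltr1n.
pose f w := log2 (Y w).
(* [g] is the tangent line of [log2] at [m], evaluated at [Y]; it dominates by concavity and its
   mean is [log2 m]. *)
pose g w := (m * ln 2)^-1 * Y w + (log2 m - (ln 2)^-1).
have fg w : f w <= g w.
  have := expR_ge1Dx (ln (Y w / m)).
  rewrite lnK ?posrE ?divr_gt0// ln_div ?posrE// => tangent.
  rewrite /f /g /log2 (_ : _ + _ = (Y w / m - 1 + ln m) / ln 2); last first.
    by rewrite invfM; ring.
  by rewrite ler_pM2r ?invr_gt0//; lra.
have gm : has_mean P g (log2 m).
  rewrite [X in has_mean P g X](_ : _ =
    (m * ln 2)^-1 * m + (log2 m - (ln 2)^-1)); last first.
    by field; rewrite !gt_eqF.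
  apply: has_meanD; first exact: has_meanZ.
  split; first exact: finite_measure_integrable_cst.
  rewrite (integral_cst P measurableT (log2 m - (ln 2)^-1)%:E).
  by rewrite -[RHS]mule1; congr (_ * _)%E; exact: probability_setT.
have [ig Eg] := gm.
have mf : measurable_fun setT (EFin \o f).
  apply/measurable_EFinP/measurable_funM => //.
  exact: measurableT_comp.
have mg : measurable_fun setT (EFin \o g) by move/integrableP : ig => [].
(* Integrability of [f] is not known, so positive and negative parts are compared separately. *)
rewrite unlock -Eg integralE [leRHS]integralE.
have le_fg w : ((EFin \o f) w <= (EFin \o g) w)%E by rewrite lee_fin.
apply: leeB; apply: ge0_le_integral => //.
- exact: measurable_funepos.
- exact: measurable_funepos.
- by move=> w _; exact: (@funepos_le _ _ setT _ _ (in1W le_fg) w (mem_set I)).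
- exact: measurable_funeneg.
- exact: measurable_funeneg.
- by move=> w _; exact: (@funeneg_le _ _ setT _ _ (in1W le_fg) w (mem_set I)).
Qed.

(** * The capacity bound *)

Theorem theorem9 (R : realType) (d : measure_display) (T : measurableType d)
  (P : probability T R) (MR MT : nat) (rho sigma2 : R)
  (g : 'I_MR -> R[i]) (h : 'I_MT -> R[i])
  (Phi : 'I_MR * 'I_MT -> {RV P >-> R}) :
  0 < rho -> 0 < sigma2 -> (MR <= MT)%N ->
  (forall k, `|g k| = 1) -> (forall k, `|h k| = 1) ->
  mutually_independent_RVs Phi ->
  (forall ij A, measurable A ->
     distribution P (Phi ij) A = normal_prob 0 (Num.sqrt sigma2) A) ->
  let H : 'M[R[i]]_(MR, MT) := \matrix_(a, b) (g a * h b) in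
  let Hhat (w : T) : 'M[R[i]]_(MR, MT) :=
    \matrix_(a, b) (H a b * (1 + 'i%C * ((Phi (a, b) w)%:C)%C)) in
  ('E_P[fun w => log2 (complex.Re (\det (1%:M +
        ((rho / MT%:R)%:C)%C *: (Hhat w *m ctrmx (Hhat w)))))]
   <= (log2 (1 + \sum_(1 <= n < MR.+1)
        (rho / MT%:R) ^+ n * sigma2 ^+ n * 'C(MR, n)%:R * 'C(MT, n)%:R
          * n`!%:R * (1 + n%:R / sigma2)))%:E)%E.
Proof.
move=> rho0 s20 _ g1 h1 indPhi Phi_normal; cbv zeta.
pose Hhat w : 'M[R[i]]_(MR, MT) := \matrix_(a, b)
  ((\matrix_(a, b) (g a * h b)) a b * (1 + 'i%C * (Phi (a, b) w)%:C%C)).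
set c := rho / MT%:R; set m := (X in log2 X).
(* [c] may vanish: for [MT = 0], division by zero returns 0. *)
have c0 : 0 <= c by rewrite divr_ge0// ltW.
have unimodular (z : R[i]) : `|z| = 1 -> z * conjc z = 1.
  by move=> z1; rewrite -sqr_normc z1 expr1n.
(* The leading 1 is the term [k = 0], and [bin_ffact] absorbs the factorial. *)
have mE : m = \sum_(k < MR.+1) (c ^+ k * sigma2 ^+ k * (1 + k%:R / sigma2))
    *+ ('C(MR, k) * (MT ^_ k)).
  rewrite /m big_ord_recl/= big_add1/= big_mkord; congr (_ + _).
    by rewrite bin0 ffactn0 mul0r addr0 !mulr1.
  apply: eq_bigr => k _; rewrite -bin_ffact /bump/= add1n.
  by rewrite -[RHS]mulr_natr !natrM; ring.
have m_gt0 : 0 < m.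
  rewrite ltr_pwDl// sumr_ge0// => k _.
  by rewrite !mulr_ge0 ?exprn_ge0 ?addr_ge0 ?divr_ge0 ?ler0n// ltW.
(* The phases of [h] cancel inside each entry of the product; those of [g] rescale rows and columns
   by constants of total product 1, fixing the diagonal of the identity. *)
have detE w : \det (1%:M + c%:C%C *: (Hhat w *m ctrmx (Hhat w))) =
    \det (\matrix_(a, b) ((a == b)%:R + \sum_k c%:C%C *
      (noisy_one P _ _ Phi w a k * conjc (noisy_one P _ _ Phi w b k)))).
  set M := (X in _ = \det X).
  transitivity (\det (\matrix_(a, b) (g a * conjc (g b) * M a b))).
    congr determinant; apply/matrixP => a b; rewrite !mxE mulrDr; congr (_ + _).
      have [->|_] := eqVneq a b; last by rewrite mulr0.
      by rewrite unimodular// mulr1.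
    rewrite !mulr_sumr; apply: eq_bigr => k _; rewrite !mxE.
    have conjM (x y : R[i]) : conjc (x * y) = conjc x * conjc y.
      exact: rmorphM.
    rewrite !conjM -/(noisy_one _ _ _ _ w a k) -/(noisy_one _ _ _ _ w b k).
    rewrite -[RHS]mulr1 -(unimodular _ (h1 k)).
    by ring.
  rewrite det_scale_rows_cols -big_split/= big1 ?mul1r => [|i _].
    by congr determinant; apply/matrixP => a b; rewrite mxE.
  exact: unimodular.
apply: (expectation_log2_le P (fun w =>
  complex.Re (\det (1%:M + c%:C%C *: (Hhat w *m ctrmx (Hhat w)))))) => //.
  move=> w; have := det_1_add_gram_gt0 c (Hhat w) c0.
  by rewrite ltcE => /andP[].
have [+ _] := has_cmean_det P _ _ Phi sigma2 s20 indPhi Phi_normal c.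
by rewrite -mE; under eq_fun do rewrite -detE.
Qed.
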